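(* Let $r\ge 2$ and $d\ge 2$ be fixed integers, let $P_k^d$ be the $d$-dimensional grid on $n=k^d$ vertices. Then $\mathcal{D}_r(P_k^d,\mathcal{T}_n)=\Theta( k^{d-1} )$ as $k\to\infty$, where the implied constants depend only on $r$ and $d$.
   Context: $P_k^d$ is the graph on vertex set $[k]^d$ in which two vertices are adjacent iff they differ in exactly one coordinate, and in that coordinate they differ by exactly $1$. Spanning-tree discrepancy: for a connected $n$-vertex graph $G$, an $r$-colouring $f:E(G)\to[r]$ of its edges, and a spanning tree $T$ of $G$ (which has $n-1$ edges), put $D_f(T) := r\cdot\left(\max_{1\le i\le r}|f^{-1}(i)\cap E(T)| - \frac{n-1}{r}\right)$. The $r$-colour spanning-tree discrepancy of $G$ is $\mathcal{D}_r(G,\mathcal{T}_n) := \min_{f:E(G)\to[r]}\ \max_{T} D_f(T)$, where the maximum is over all spanning trees $T$ of $G$. *)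

(* Defs.v *)
From HB Require Import structures.
From mathcomp Require Export all_boot all_order all_algebra.
From mathcomp Require Export all_classical all_reals all_analysis.
Export Order.TTheory GRing.Theory Num.Theory.
Export numFieldNormedType.Exports.

Set Implicit Arguments.
Unset Strict Implicit.
Unset Printing Implicit Defensive.

Local Open Scope ring_scope.

Record sgraph := SGraph {
  vertex :> finType;
  adj : rel vertex;
  adj_sym : symmetric adj;
  adj_irrefl : irreflexive adj }.

Section Graph.
Variable G : sgraph.

Definition edges : {set {set G}} :=
  [set e | [exists x, exists y, adj x y && (e == [set x; y])]].

Definition edge : finType := {e : {set G} | e \in edges}.

(* A spanning subgraph of G is given by its set of edges T. *)
Definition sub_adj (T : {set edge}) : rel G :=
  [rel x y | [exists e in T, val e == [set x; y]]].

Definition connectedb (T : {set edge}) : bool :=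
  [forall x, forall y, connect (sub_adj T) x y].

(* Cycles are duplicate-free closed walks on at least 3 vertices; the length
   bound #|G| only serves to make the quantification finite (acyclicP). *)
Definition acyclic (T : {set edge}) : bool :=
  [forall m : 'I_#|G|.+1, forall c : m.-tuple G,
    (2 < m)%N ==> ~~ ucycleb (sub_adj T) c].

Definition spanning_tree (T : {set edge}) : bool := connectedb T && acyclic T.

Lemma acyclicP (T : {set edge}) :
  reflect (forall c : seq G, (2 < size c)%N -> ~ ucycle (sub_adj T) c)
          (acyclic T).
Proof.
apply: (iffP forallP) => [acT c c3 /[dup] cyc /andP[_ uc] | acT m].
  have cG : (size c < #|G|.+1)%N by rewrite ltnS -(card_uniqP uc) max_card.
  have /forallP/(_ (in_tuple c)) := acT (Ordinal cG).
  by rewrite /= c3 /= => /negP; apply; exact: cyc.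
apply/forallP => c; apply/implyP => m3; apply/negP.
by apply: acT; rewrite size_tuple.
Qed.

(* D_f(T) = r (max_i |f^{-1}(i) \cap E(T)| - (n - 1) / r) *)
Definition tree_discrepancy (R : realType) (r : nat)
    (f : {ffun edge -> 'I_r}) (T : {set edge}) : R :=
  r%:R * ((\max_(i < r) #|[set e in T | f e == i]|)%:R
          - (#|G|%:R - 1) / r%:R).

(* The minimum and the maximum are taken over finite sets of extended reals,
   with neutral elements +oo and -oo; these sets are nonempty, hence the value
   is a real number, as soon as G is connected and r > 0. *)
Definition spanning_tree_discrepancy (R : realType) (r : nat) : R :=
  fine (\big[Order.min/+oo%E]_(f : {ffun edge -> 'I_r})
          \big[Order.max/-oo%E]_(T : {set edge} | spanning_tree T)
            (tree_discrepancy R f T)%:E).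

End Graph.

(* The vertex set [k]^d is represented by {0, ..., k-1}^d. *)
Definition grid_adj (k d : nat) : rel {ffun 'I_d -> 'I_k} :=
  [rel x y : {ffun 'I_d -> 'I_k} |
    [exists i, (`|(x i : nat) - (y i : nat)|%N == 1%N)
               && [forall j, (j != i) ==> (x j == y j)]]].

Lemma grid_adj_sym (k d : nat) : symmetric (@grid_adj k d).
Proof.
move=> x y; apply: eq_existsb => i /=; rewrite distnC; congr (_ && _).
by apply: eq_forallb => j; rewrite [y j == _]eq_sym.
Qed.

Lemma grid_adj_irrefl (k d : nat) : irreflexive (@grid_adj k d).
Proof. by move=> x; apply/existsP => -[i] /=; rewrite distnn. Qed.

Definition grid (k d : nat) : sgraph :=
  SGraph (@grid_adj_sym k d) (@grid_adj_irrefl k d).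

Lemma card_grid (k d : nat) : #|grid k d| = (k ^ d)%N.
Proof. by rewrite card_ffun !card_ord. Qed.

Lemma eqTheta_nearP (R : realType) (f g : nat -> R) :
  (f =Theta_(\oo) g)%classic <->
  exists c C : R, [/\ 0 < c, 0 < C &
    (\forall k \near \oo, c * `|g k| <= `|f k| <= C * `|g k|)%classic].
Proof.
rewrite eqThetaE qualifE; split => [/asboolP[[c C] /andP[c0 C0] H]|].
  by exists c, C; split=> //; apply: filterS H => k [-> ->].
move=> [c [C [c0 C0 H]]]; apply/asboolP; exists (c, C) => /=; first by rewrite c0.
by apply: filterS H => k /andP[].
Qed.

(* Main.v *)
(* Over F_2, edge sets whose incidence vectors are independent are the acyclic
   ones, so a spanning tree can be chosen to contain as many edges of a colour i
   as the rank of the i-th colour class.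

   Lower bound: let A be a colour class of maximal rank a, and B the union of
   the others. Then r a >= rank A + rank B = n - 1 + dim (U_A /\ U_B), where U_A
   and U_B are the spans of A and B. Every vertex meeting both A and B lies on a
   4-cycle whose edges are not all in A nor all in B, and the sum of the A-edges
   of this cycle is a nonzero vector of U_A /\ U_B; these vectors are independent
   for vertices with the same coordinates mod 2. There are many such vertices Z:
   every canonical path from a vertex meeting A to one meeting B goes through Z,
   and a given vertex is on at most d k^(d+1) canonical paths.

   Upper bound: colour the grid by r slabs of width about k / r; a forest has at
   most as many edges as vertices. *)
Require Import Defs.
From mathcomp Require Import zify.
(* Gives the finite-set lemmas precedence over their namesakes on classical sets. *)
From mathcomp Require Import fintype finset.

Set Implicit Arguments.
Unset Strict Implicit.
Unset Printing Implicit Defensive.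

Local Open Scope ring_scope.

(** * Spans of finite families of vectors, independent subfamilies and bases *)

Section FamilySpan.
Variables (K : fieldType) (V : vectType K) (I : finType) (b : I -> V).
Implicit Types (S X : {set I}) (U : {vspace V}).

Definition vspan S : {vspace V} := (\sum_(e in S) <[b e]>)%VS.

Lemma vspan_subP S U : reflect {in S, forall e, b e \in U} (vspan S <= U)%VS.
Proof. by apply: (iffP subv_sumP) => h e /h; rewrite memvE. Qed.

Lemma mem_vspan S e : e \in S -> b e \in vspan S.
Proof. by move=> eS; apply: (vspan_subP S _ (subvv _)). Qed.

Lemma vspanS S X : S \subset X -> (vspan S <= vspan X)%VS.
Proof. by move=> /subsetP sSX; apply/vspan_subP => e /sSX /mem_vspan. Qed.

Lemma dim_vspan_leq S : (\dim (vspan S) <= #|S|)%N.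
Proof.
apply: leq_trans (dimv_leq_sum _ _ _) _; rewrite -sum1_card.
by apply: leq_sum => e _; rewrite dim_vline; case: eqP.
Qed.

Lemma dim_vspanU1 e S :
  b e \notin vspan S -> \dim (vspan (e |: S)) = (\dim (vspan S)).+1.
Proof.
move=> beS; have eS : e \notin S by apply: contra beS => /mem_vspan.
rewrite /vspan big_setU1 //= -/(vspan S) dimv_disjoint_sum.
  by rewrite dim_vline; case: eqP beS => // ->; rewrite mem0v.
apply/eqP; rewrite -subv0; apply/subvP => u /memv_capP [/vlineP [k ->]].
have [-> _|k0 kbe] := eqVneq k 0; first by rewrite scale0r mem0v.
by case/negP: beS; rewrite -[b e]scale1r -(mulVf k0) -scalerA memvZ.
Qed.

Lemma dim_vspan_free S :
  {in S, forall e, b e \notin vspan (S :\ e)} -> \dim (vspan S) = #|S|.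
Proof.
have [n] := ubnP #|S|; elim: n S => // n IH S ltSn freeS.
have [->|[e eS]] := set_0Vmem S; first by rewrite /vspan big_set0 dimv0 cards0.
rewrite -{1}(setD1K eS) dim_vspanU1 ?freeS // (cardsD1 e S) eS add1n.
rewrite IH //; first by move: ltSn; rewrite (cardsD1 e S) eS.
move=> e' /setD1P[_ e'S]; apply: contra (freeS _ e'S).
by apply/subvP/vspanS/setSD/subsetDl.
Qed.

Lemma vspan_free_notin S e :
  \dim (vspan S) = #|S| -> e \in S -> b e \notin vspan (S :\ e).
Proof.
move=> dS eS; apply/negP => beS.
have : (vspan S <= vspan (S :\ e))%VS.
  apply/vspan_subP => e' e'S; have [->//|e'e] := eqVneq e' e.
  by apply: mem_vspan; rewrite !inE e'e.
move/dimvS; rewrite dS leqNgt => /negP; apply.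
by apply: leq_ltn_trans (dim_vspan_leq _) _; rewrite (cardsD1 e S) eS.
Qed.

(** An independent set between [S] and [X] that is maximal for inclusion spans [X], since any vector
    of [X] outside its span could be added to it. *)
Lemma vspan_extend S X : S \subset X -> \dim (vspan S) = #|S| ->
  exists T : {set I},
    [/\ S \subset T, T \subset X, \dim (vspan T) = #|T| & vspan T = vspan X].
Proof.
move=> sSX dS.
pose P (T : {set I}) := (T \subset X) && (\dim (vspan T) == #|T|).
have PS : P S by rewrite /P sSX dS eqxx.
have [T /maxsetP[/andP[sTX /eqP dT] maxT] sST] := maxset_exists PS.
exists T; split=> //; apply: subv_anti; rewrite vspanS //=.
apply/vspan_subP => e eX; apply: contraT => beT.
have eT : e \notin T by apply: contra beT => /mem_vspan.
have : P (e |: T).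
  by rewrite /P subUset sub1set eX sTX dim_vspanU1 // dT cardsU1 eT eqxx.
by move/maxT => /(_ (subsetUr _ _)) eTT; case/negP: eT; rewrite -eTT setU11.
Qed.

End FamilySpan.

Local Notation F2 := ('F_2)^o.

(** * Incidence vectors over F_2: span as connectedness, independence as acyclicity *)

Section Incidence.
Variable G : sgraph.
Implicit Types (S T : {set edge G}) (C W : {set G}) (x y : G).

Definition unit_vec x : {ffun G -> F2} := [ffun z => (z == x)%:R].

Definition incidence (e : edge G) : {ffun G -> F2} :=
  [ffun z => (z \in val e)%:R].

Definition espan S : {vspace {ffun G -> F2}} := vspan incidence S.

Lemma F2_addrr (v : {ffun G -> F2}) : v + v = 0.
Proof.
apply/ffunP => z; rewrite !ffunE.
exact: (addrr_pchar2 (pchar_Fp (isT : prime 2))).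
Qed.

Lemma edge_mem x y : adj x y -> [set x; y] \in edges G.
Proof. by move=> xy; rewrite inE; apply/existsP; exists x; apply/existsP; exists y; rewrite xy eqxx. Qed.

Lemma edgeP (e : edge G) : exists x y, adj x y /\ val e = [set x; y].
Proof.
have := valP e; rewrite inE => /existsP[x /existsP[y /andP[xy /eqP exy]]].
by exists x, y.
Qed.

Lemma adj_neq x y : adj x y -> x != y.
Proof. by apply: contraTneq => ->; rewrite adj_irrefl. Qed.

Lemma incidenceE (e : edge G) x y :
  adj x y -> val e = [set x; y] -> incidence e = unit_vec x + unit_vec y.
Proof.
move=> /adj_neq xy exy; apply/ffunP => z; rewrite !ffunE exy !inE.
case: eqVneq => [->|_] /=; first by rewrite (negPf xy) addr0.
by rewrite add0r.
Qed.

Lemma sub_adjP T x y :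
  reflect (exists2 e, e \in T & val e = [set x; y]) (sub_adj T x y).
Proof.
apply: (iffP existsP) => [[e /andP[eT /eqP exy]]|[e eT exy]]; exists e => //.
by rewrite eT exy eqxx.
Qed.

Lemma sub_adj_adj T x y : sub_adj T x y -> adj x y.
Proof.
case/sub_adjP => e _ exy; have [a [c [ac eac]]] := edgeP e.
have /set2P xac : x \in [set a; c] by rewrite -eac exy set21.
have /set2P yac : y \in [set a; c] by rewrite -eac exy set22.
have /set2P axy : a \in [set x; y] by rewrite -exy eac set21.
have /set2P cxy : c \in [set x; y] by rewrite -exy eac set22.
case: xac yac axy cxy => -> [] -> // [] ca [] ac'.
all: by [rewrite // adj_sym | move: (adj_neq ac); rewrite ?ca ?ac' ?eqxx].
Qed.

Lemma sub_adj_sym T : symmetric (sub_adj T).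
Proof. by move=> x y; apply/sub_adjP/sub_adjP => -[e eT exy]; exists e; rewrite // exy setUC. Qed.

Lemma incidence_sub_adj T x y :
  sub_adj T x y -> unit_vec x + unit_vec y \in espan T.
Proof.
move=> xyT; case/sub_adjP: (xyT) => e eT exy.
by rewrite -(incidenceE (sub_adj_adj xyT) exy) mem_vspan.
Qed.

Lemma unit_vec_chain (U : {vspace {ffun G -> F2}}) y x z :
  unit_vec x + unit_vec y \in U -> unit_vec y + unit_vec z \in U ->
  unit_vec x + unit_vec z \in U.
Proof.
move=> xy yz; have := memvD xy yz.
by rewrite addrA -(addrA (unit_vec x)) F2_addrr addr0.
Qed.

Lemma connect_espan T x y :
  connect (sub_adj T) x y -> unit_vec x + unit_vec y \in espan T.
Proof.
case/connectP => p; elim: p x => [|z p IH] x /=; first by move=> _ ->; rewrite F2_addrr mem0v.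
by case/andP=> /incidence_sub_adj xz /IH yP /yP; apply: unit_vec_chain.
Qed.

(** Summing the values over [C] is a linear functional, which vanishes on a span once it vanishes on
    the generators. It serves to show that a vector is outside a span. *)
Lemma sum_vspan (I : finType) (b : I -> {ffun G -> F2}) (J : {set I}) C u :
  {in J, forall i, \sum_(x in C) b i x = 0} ->
  u \in vspan b J -> \sum_(x in C) u x = 0.
Proof.
move=> h /memv_sumP[v vP ->].
under eq_bigr do rewrite sum_ffunE.
rewrite exchange_big big1 //= => i iJ.
have /vlineP[k ->] := vP _ iJ.
under eq_bigr do rewrite ffunE.
by rewrite -scaler_sumr h // scaler0.
Qed.

(** Evaluation at [x] kills every other vector of the family but not [b x]. *)
Lemma dim_vspan_dual (b : G -> {ffun G -> F2}) W :
  {in W, forall x, b x x != 0} -> {in W &, forall x y, x != y -> b x y = 0} ->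
  \dim (vspan b W) = #|W|.
Proof.
move=> b1 b0; apply: dim_vspan_free => x xW; apply: contra (b1 x xW) => bx.
have := @sum_vspan _ b (W :\ x) [set x] _ _ bx; rewrite big_set1 => -> //.
by move=> y /setD1P[yx yW]; rewrite big_set1 b0.
Qed.

Lemma sum_unit_vec C x : \sum_(z in C) unit_vec x z = (x \in C)%:R.
Proof.
under eq_bigr do rewrite ffunE.
have [xC|xC] := boolP (x \in C).
  by rewrite (big_setD1 x) //= eqxx big1 ?addr0 // => z /setD1P[/negPf ->].
by rewrite big1 // => z zC; case: eqP zC xC => // -> ->.
Qed.

(** Let [C] be the component of [x]. Each edge of [T] has both or none of its ends in [C], so the
    sum over [C] vanishes on the span; on [unit_vec x + unit_vec y] it vanishes only if [y] is in
    [C]. *)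
Lemma espan_connect T x y :
  unit_vec x + unit_vec y \in espan T -> connect (sub_adj T) x y.
Proof.
move=> xyT; pose C := [set z | connect (sub_adj T) x z].
suff : (x \in C) && (y \in C) by rewrite !inE => /andP[].
have : \sum_(z in C) (unit_vec x + unit_vec y) z = 0.
  apply: sum_vspan xyT => e eT; have [a [c [ac exy]]] := edgeP e.
  rewrite (incidenceE ac exy); under eq_bigr do rewrite ffunE.
  rewrite big_split /= !sum_unit_vec !inE.
  have acT : connect (sub_adj T) a c by apply/connect1/sub_adjP; exists e.
  rewrite (same_connect_r _ acT); first exact: (addrr_pchar2 (pchar_Fp (isT : prime 2))).
  exact/sym_connect_sym/sub_adj_sym.
under eq_bigr do rewrite ffunE.
rewrite big_split /= !sum_unit_vec !inE connect0.
by case: connect.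
Qed.

Lemma free_acyclic T : \dim (espan T) = #|T| -> acyclic T.
Proof.
move=> freeT; apply/acyclicP => -[|x [|y p]] //= p3 /andP[/= /andP[xy pT]].
move=> /and3P[xp yp up].
case/sub_adjP: (xy) => e eT exy.
have := vspan_free_notin freeT eT; rewrite (incidenceE (sub_adj_adj xy) exy).
case/negP; rewrite addrC; apply: connect_espan; apply/connectP.
(* The rest of the cycle leads from [y] back to [x] without using [e], so the vector of [e] depends
   on the others. *)
exists (rcons p x); last by rewrite last_rcons.
have keep (a c : G) : sub_adj T a c -> [set a; c] != [set x; y] -> sub_adj (T :\ e) a c.
  move=> /sub_adjP[e' e'T e'ac] ne; apply/sub_adjP; exists e' => //.
  by rewrite !inE e'T andbT; apply: contra ne => /eqP e'e; rewrite -e'ac e'e exy.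
move: pT; rewrite !rcons_path => /andP[pT zx]; apply/andP; split.
  apply: (@sub_in_path _ [pred a | a \in y :: p] _ _ _ _ _ _ pT) => [a c ap cp ac|].
    apply: keep ac _; apply: contraNneq xp => /setP/(_ x).
    by rewrite !inE eqxx /= => /orP[] /eqP ->.
  by apply/allP => a /=.
(* The closing edge differs from [e]: since the cycle has at least 3 vertices, its end other than
   [x] lies in [p], and [y] does not. *)
apply: (keep) => //; apply: contraNneq yp => /setP/(_ y).
rewrite !inE eqxx orbT; case/orP => /eqP yE; last by rewrite yE inE eqxx in xp.
move: yE => ->.
by case: p p3 {xp up pT zx} => // t p _; rewrite /= mem_last.
Qed.

(** If the vector of an edge depends on the others, its ends are joined by a simple path of other
    edges, which the edge closes into a cycle. That path has at least two edges, because an edge is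
    determined by its ends. *)
Lemma acyclic_free T : acyclic T -> \dim (espan T) = #|T|.
Proof.
move=> /acyclicP acT; apply: dim_vspan_free => e eT; apply/negP.
have [x [y [xy exy]]] := edgeP e.
rewrite (incidenceE xy exy) => /espan_connect/connectP[p0 p0T].
case/shortenP: p0T => p pT up _ {p0} yE.
have sub : subrel (sub_adj (T :\ e)) (sub_adj T).
  by move=> a c /sub_adjP[e' /setD1P[_ e'T] e'E]; apply/sub_adjP; exists e'.
apply: (acT (x :: p)).
  case: p yE pT up => [yx|z [|//]] /=; first by rewrite yx adj_irrefl in xy.
  move=> yz; rewrite andbT => /sub_adjP[e' /setD1P[ne _]]; rewrite -yz -exy.
  by move/val_inj/eqP; rewrite (negPf ne).
apply/andP; split=> //=; rewrite rcons_path (sub_path sub pT) -yE /=.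
by apply/sub_adjP; exists e; rewrite // exy setUC.
Qed.

Lemma basis_spanning_tree T :
  (forall x y, unit_vec x + unit_vec y \in espan T) ->
  \dim (espan T) = #|T| -> spanning_tree T.
Proof.
move=> span freeT; rewrite /spanning_tree free_acyclic // andbT.
by apply/forallP => x; apply/forallP => y; apply: espan_connect.
Qed.

Lemma dim_espan_verts S W : {in S, forall e : edge G, val e \subset W} ->
  (\dim (espan S) <= #|W|)%N.
Proof.
move=> SW; apply: leq_trans (dim_vspan_leq unit_vec W).
apply: dimvS; apply/vspan_subP => e /SW; have [x [y [xy exy]]] := edgeP e.
rewrite exy subUset !sub1set (incidenceE xy exy) => /andP[xW yW].
by rewrite memvD // mem_vspan.
Qed.

(** Adding the single vector [unit_vec x0] to the span yields every unit vector, hence a space of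
    dimension [#|G|]. *)
Lemma leq_dim_espan S (x0 : G) :
  (forall x, unit_vec x + unit_vec x0 \in espan S) ->
  (#|G| <= (\dim (espan S)).+1)%N.
Proof.
move=> span.
have full : (vspan unit_vec [set: G] <= espan S + <[unit_vec x0]>)%VS.
  apply/vspan_subP => x _; rewrite -[unit_vec x]addr0 -(F2_addrr (unit_vec x0)).
  by rewrite addrA memv_add ?memv_line.
have free : \dim (vspan unit_vec [set: G]) = #|G|.
  rewrite -cardsT; apply: dim_vspan_dual => [x _|x y _ _ xy]; rewrite !ffunE.
    by rewrite eqxx.
  by rewrite eq_sym (negPf xy).
have le1 : (\dim <[unit_vec x0]> <= 1)%N by rewrite dim_vline; case: eqP.
have [le2 _] := dimv_add_leqif (espan S) <[unit_vec x0]>.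
have := leq_trans (dimvS full) le2; rewrite free => /leq_trans; apply.
by rewrite -(addn1 (\dim (espan S))) leq_add2l.
Qed.

End Incidence.

(** * Ranks of colour classes in a connected graph *)

Section Colouring.
Variables (G : sgraph) (r : nat) (f : {ffun edge G -> 'I_r}).
Hypothesis connG : forall x y : G, unit_vec x + unit_vec y \in espan [set: edge G].

Definition colour_class i : {set edge G} := [set e | f e == i].

(** A basis of the colour class is extended to a basis of the span of all edges, which is a spanning
    tree. *)
Lemma ex_colour_tree i : exists2 T : {set edge G}, spanning_tree T &
  (\dim (espan (colour_class i)) <= #|[set e in T | f e == i]|)%N.
Proof.
have free0 : \dim (vspan (@incidence G) set0) = #|(set0 : {set edge G})|.
  by rewrite /vspan big_set0 dimv0 cards0.
have [S [_ Si freeS spanS]] := vspan_extend (sub0set (colour_class i)) free0.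
have [T [ST _ freeT spanT]] := vspan_extend (subsetT S) freeS.
exists T; first by apply: basis_spanning_tree => // x y; rewrite /espan spanT; apply: connG.
rewrite /espan -spanS freeS; apply/subset_leq_card/subsetP => e eS.
by have := subsetP Si _ eS; rewrite !inE (subsetP ST).
Qed.

(** This is the dimension formula for a sum of two subspaces, the sum being here the span of all
    edges, of dimension at least [#|G| - 1]. *)
Lemma rank_sum_setC (A : {set edge G}) :
  (#|G| + \dim (espan A :&: espan (~: A)) <=
     (\dim (espan A) + \dim (espan (~: A))).+1)%N.
Proof.
have spanU : (espan [set: edge G] <= espan A + espan (~: A))%VS.
  apply/vspan_subP => e _; have [eA|eA] := boolP (e \in A).
    by rewrite (subvP (addvSl _ _)) ?mem_vspan.
  by apply: (subvP (addvSr _ _)); apply: mem_vspan; rewrite in_setC.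
have := dimv_sum_cap (espan A) (espan (~: A)); have := dimvS spanU.
have [x0 _|G0] := pickP G; last by rewrite (eq_card0 G0); lia.
by have := leq_dim_espan (fun x => connG x x0); lia.
Qed.

(** Rank is subadditive, so the union of the [r - 1] other colours has rank at most
    [(r - 1) * M]. *)
Lemma rank_sum_colours i M : (forall j, \dim (espan (colour_class j)) <= M)%N ->
  (\dim (espan (colour_class i)) + \dim (espan (~: colour_class i)) <= r * M)%N.
Proof.
move=> leM; set A := colour_class i.
have leB : (\dim (espan (~: A)) <= \sum_(j < r | j != i) M)%N.
  have sub : (espan (~: A) <= \sum_(j < r | j != i) espan (colour_class j))%VS.
    apply/vspan_subP => e; rewrite !inE => ei.
    by apply: (subvP (sumv_sup (f e) ei (subvv _))); rewrite mem_vspan // inE.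
  apply: leq_trans (dimvS sub) _; apply: leq_trans (dimv_leq_sum _ _ _) _.
  by apply: leq_sum => j _.
have -> : (r * M = M + \sum_(j < r | j != i) M)%N.
  by rewrite -(bigD1 i (P := predT) (F := fun=> M)) //= sum_nat_const card_ord.
by rewrite leq_add // leM.
Qed.

End Colouring.

(** * Two-coloured 4-cycles and vertices touched by an edge set *)

Section Square.
Variables (G : sgraph) (A : {set edge G}).

Lemma adj_colour x y : adj x y -> sub_adj A x y || sub_adj (~: A) x y.
Proof.
move=> xy; pose e : edge G := Sub [set x; y] (edge_mem xy).
have [eA|eA] := boolP (e \in A); apply/orP; [left|right]; apply/sub_adjP; exists e => //.
by rewrite inE.
Qed.

Lemma adj_espan x y : adj x y -> unit_vec x + unit_vec y \in espan [set: edge G].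
Proof.
move=> xy; pose e : edge G := Sub [set x; y] (edge_mem xy).
by rewrite -(@incidenceE _ e) // mem_vspan // inE.
Qed.

(* The edges of a 4-cycle sum to zero, so its [A]-edges and its other edges
   have the same sum [w]. *)
Lemma square_cap z a b q : z != q -> sub_adj A z a -> sub_adj (~: A) z b ->
  adj a q -> adj b q ->
  exists w : {ffun G -> F2}, [/\ w \in (espan A :&: espan (~: A))%VS, w z != 0
    & forall x, x \notin [:: z; a; b; q] -> w x = 0].
Proof.
move=> zq za zb aq bq.
have := adj_neq (sub_adj_adj za); have := adj_neq (sub_adj_adj zb).
have := incidence_sub_adj za; have := incidence_sub_adj zb => zbU zaU zb' za'.
have symU S (x y : G) : sub_adj S x y -> unit_vec y + unit_vec x \in espan S.
  by rewrite addrC; apply: incidence_sub_adj.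
(* In each of the four cases the witness is the sum of the [A]-edges after cancellation. Its value
   at [z] is 1 because exactly one of the two cycle edges at [z] is in [A]. *)
case/orP: (adj_colour aq) (adj_colour bq) => aqS /orP[] bqS.
- exists (unit_vec z + unit_vec b); split.
  + rewrite memv_cap zbU andbT; apply: unit_vec_chain (symU _ _ _ bqS).
    exact: unit_vec_chain zaU (incidence_sub_adj aqS).
  + by rewrite !ffunE eqxx (negPf zb').
  + by move=> x; rewrite !inE !negb_or !ffunE => /and4P[/negPf-> _ /negPf-> _]; rewrite addr0.
- exists (unit_vec z + unit_vec q); split.
  + rewrite memv_cap (unit_vec_chain zaU (incidence_sub_adj aqS)).
    exact: unit_vec_chain zbU (incidence_sub_adj bqS).
  + by rewrite !ffunE eqxx (negPf zq).
  + by move=> x; rewrite !inE !negb_or !ffunE => /and4P[/negPf-> _ _ /negPf->]; rewrite addr0.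
- exists (unit_vec z + unit_vec a + (unit_vec b + unit_vec q)); split.
  + rewrite memv_cap memvD ?(incidence_sub_adj bqS) //.
    by rewrite addrACA memvD // (incidence_sub_adj aqS).
  + by rewrite !ffunE eqxx (negPf zq) (negPf zb') (negPf za').
  + move=> x; rewrite !inE !negb_or !ffunE.
    by move=> /and4P[/negPf-> /negPf-> /negPf-> /negPf->]; rewrite !addr0.
- exists (unit_vec z + unit_vec a); split.
  + rewrite memv_cap zaU; apply: unit_vec_chain (symU _ _ _ aqS).
    exact: unit_vec_chain zbU (incidence_sub_adj bqS).
  + by rewrite !ffunE eqxx (negPf za').
  + by move=> x; rewrite !inE !negb_or !ffunE => /and4P[/negPf-> /negPf-> _ _]; rewrite addr0.
Qed.

Definition touched (S : {set edge G}) : {set G} := [set x | [exists y, sub_adj S x y]].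

Lemma touchedP (S : {set edge G}) x : reflect (exists y, sub_adj S x y) (x \in touched S).
Proof. by rewrite inE; apply: existsP. Qed.

Lemma sub_adj_touched (S : {set edge G}) x y : sub_adj S x y -> x \in touched S.
Proof. by move=> xy; apply/touchedP; exists y. Qed.

Lemma dim_espan_touched (S : {set edge G}) : (\dim (espan S) <= #|touched S|)%N.
Proof.
apply: dim_espan_verts => e eS; have [x [y [_ exy]]] := edgeP e.
have xyS : sub_adj S x y by apply/sub_adjP; exists e.
rewrite exy subUset !sub1set (sub_adj_touched xyS).
by rewrite sub_adj_sym in xyS; apply: sub_adj_touched xyS.
Qed.

End Square.

(** * Canonical paths in the grid and vertices meeting both edge sets *)

Section Grid.
Variables (k d : nat).
Local Notation point := {ffun 'I_d -> 'I_k}.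
Implicit Types (x y z : point).

Definition upd z (i : 'I_d) (t : 'I_k) : point :=
  [ffun j => if j == i then t else z j].

Lemma adj_upd z i (t : 'I_k) : `|(z i : nat) - (t : nat)|%N = 1%N ->
  adj (z : grid k d) (upd z i t).
Proof.
move=> zt; apply/existsP; exists i; rewrite ffunE eqxx zt eqxx /=.
by apply/forallP => j; apply/implyP => /negPf ji; rewrite ffunE ji.
Qed.

Lemma adj_gridP x y : adj (x : grid k d) y ->
  exists i (t : 'I_k), y = upd x i t /\ `|(x i : nat) - (t : nat)|%N = 1%N.
Proof.
case/existsP => i /andP[/eqP xy /forallP eq_xy]; exists i, (y i); split=> //.
apply/ffunP => j; rewrite ffunE; case: eqVneq => [->//|ji].
by have := eq_xy j; rewrite ji /= => /eqP ->.
Qed.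

Lemma line_closed (P : pred 'I_k) :
  (forall t t' : 'I_k, `|(t : nat) - (t' : nat)|%N = 1%N -> P t -> P t') ->
  forall t t', P t -> P t'.
Proof.
move=> stepP t t'; move En : `|(t : nat) - (t' : nat)|%N => n.
elim: n t En => [|n IH] t En Pt; first by have <- : t = t' by apply: val_inj => /=; lia.
have [tt'|t't] := ltnP t t'.
  have tk : (t.+1 < k)%N by have := ltn_ord t'; lia.
  by apply: (IH (Ordinal tk)) => /=; [lia | apply: stepP Pt => /=; lia].
have tk : (t.-1 < k)%N by have := ltn_ord t; lia.
by apply: (IH (Ordinal tk)) => /=; [lia | apply: stepP Pt => /=; lia].
Qed.

(* The canonical path from [x] to [y] replaces the coordinates of [x] by those
   of [y] one after the other; [cpath x y i t] is its point with [i]-th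
   coordinate [t] while coordinate [i] is being changed. *)
Definition cpath x y (i : 'I_d) (t : 'I_k) : point :=
  [ffun j : 'I_d => if (j < i)%N then y j else if j == i then t else x j].

Lemma adj_cpath x y i (t t' : 'I_k) : `|(t : nat) - (t' : nat)|%N = 1%N ->
  adj (cpath x y i t : grid k d) (cpath x y i t').
Proof.
move=> tt'; suff -> : cpath x y i t' = upd (cpath x y i t) i t'.
  by apply: adj_upd; rewrite ffunE ltnn eqxx.
by apply/ffunP => j; rewrite !ffunE; case: eqVneq => [->|]; rewrite ?ltnn.
Qed.

Lemma cpath_closed (P : pred point) x y :
  (forall i (t t' : 'I_k), `|(t : nat) - (t' : nat)|%N = 1%N ->
     P (cpath x y i t) -> P (cpath x y i t')) ->
  P x -> P y.
Proof.
(* [h m] is the turning point of the canonical path at which the first [m] coordinates are already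
   those of [y]. *)
move=> stepP Px; pose h m : point := [ffun j : 'I_d => if (j < m)%N then y j else x j].
have Ph m : (m <= d)%N -> P (h m).
  elim: m => [_|m IH md]; first by have -> : h 0%N = x by apply/ffunP => j; rewrite ffunE.
  pose i := Ordinal md.
  have hm : h m = cpath x y i (x i).
    by apply/ffunP => j; rewrite !ffunE /=; case: ltnP => // _; case: eqVneq => [->|].
  have -> : h m.+1 = cpath x y i (y i).
    apply/ffunP => j; rewrite !ffunE /= ltnS leq_eqVlt -(inj_eq val_inj) /=.
    by case: eqVneq => [jm|_] /=; [rewrite jm ltnn; congr (y _); apply: val_inj | case: ltnP].
  apply: (line_closed (P := fun t => P (cpath x y i t))) (x i) (y i) _; first exact: stepP.
  by rewrite -hm; apply/IH/ltnW.
by have <- : h d = y; [apply/ffunP => j; rewrite ffunE ltn_ord | apply: Ph].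
Qed.

Lemma grid_connected (x y : grid k d) :
  unit_vec x + unit_vec y \in espan [set: edge (grid k d)].
Proof.
pose P (u : point) := unit_vec (x : grid k d) + unit_vec (u : grid k d) \in espan [set: edge (grid k d)].
apply: (@cpath_closed P x y); rewrite /P; last by rewrite F2_addrr mem0v.
by move=> i t t' tt' xt; apply: unit_vec_chain xt (adj_espan (adj_cpath x y i tt')).
Qed.

(* A pair (x, y) is determined by a point [z = cpath x y i t] of its canonical
   path, [i], [x i] and the coordinates which [z] lacks. *)
Lemma card_pairs_cpath (X Y Z : {set point}) :
  (forall x y, x \in X -> y \in Y -> exists i t, cpath x y i t \in Z) ->
  (#|X| * #|Y| <= #|Z| * (d * (k ^ d * k)))%N.
Proof.
move=> h; rewrite -cardsX.
(* [g] is the decoder: [w] agrees with [x] before direction [i] and with [y] from [i] on, and [a] is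
   [x i]. *)
pose g (u : point * ('I_d * (point * 'I_k))) : point * point :=
  let: (z, (i, (w, a))) := u in
  ([ffun j : 'I_d => if (j < i)%N then w j else if j == i then a else z j],
   [ffun j : 'I_d => if (j < i)%N then z j else w j]).
have sub : setX X Y \subset g @: setX Z [set: 'I_d * (point * 'I_k)].
  apply/subsetP => -[x y] /setXP[xX yY]; have [i [t xyZ]] := h x y xX yY.
  apply/imsetP; exists (cpath x y i t, (i, ([ffun j : 'I_d => if (j < i)%N then x j else y j], x i))).
    by rewrite !inE /= xyZ.
  congr pair; apply/ffunP => j; rewrite !ffunE; case: ltnP => // _.
  by case: eqVneq => [->|].
apply: leq_trans (subset_leq_card sub) _; apply: leq_trans (leq_imset_card _ _) _.
by rewrite cardsX cardsT !card_prod card_ffun !card_ord.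
Qed.

(** Along a canonical path that avoids vertices touched by both sets, being untouched by [~: A]
    propagates: the next edge must be in [A], so its far end is touched by [A] and hence not by
    [~: A]. Such a path cannot end in [touched (~: A)]. *)
Lemma touched_pairs (A : {set edge (grid k d)}) : (0 < d)%N ->
  (#|touched A| * #|touched (~: A)| <=
     #|touched A :&: touched (~: A)| * (d * (k ^ d * k)))%N.
Proof.
move=> d0; apply: card_pairs_cpath => x y xX yY.
have [xY|xY] := boolP (x \in touched (~: A)).
  exists (Ordinal d0), (x (Ordinal d0)).
  have -> : cpath x y (Ordinal d0) (x (Ordinal d0)) = x.
    by apply/ffunP => j; rewrite !ffunE ltn0; case: eqP => [->|].
  by rewrite in_setI xX.
suff /existsP[i /existsP[t]] : [exists i, exists t, cpath x y i t \in touched A :&: touched (~: A)].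
  by exists i, t.
apply: contraT => /existsPn noZ.
suff : y \notin touched (~: A) by rewrite yY.
apply: (@cpath_closed (fun u => u \notin touched (~: A)) x y) => // i t t' tt' tY.
have /existsPn/(_ t') := noZ i.
rewrite in_setI negb_and; case/orP => // /negP[].
have := adj_colour A (adj_cpath x y i tt') => /orP[] tt'S.
  by rewrite sub_adj_sym in tt'S; apply: sub_adj_touched tt'S.
by case/negP: tY; apply: sub_adj_touched tt'S.
Qed.

(** If the two given edges at [z] have the same direction, take an edge at [z] in another direction:
    it is in [A] or in [~: A] and replaces the given edge from that set. *)
Lemma bichromatic_corner (A : {set edge (grid k d)}) z : (1 < k)%N -> (1 < d)%N ->
  z \in touched A :&: touched (~: A) ->
  exists i j t s, [/\ i != j, sub_adj A (z : grid k d) (upd z i t)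
    & sub_adj (~: A) (z : grid k d) (upd z j s)].
Proof.
move=> k1 d1 /setIP[zA zB].
have [a za] := elimT (touchedP A (z : grid k d)) zA.
have [b zb] := elimT (touchedP (~: A) (z : grid k d)) zB.
have [i [t [aE _]]] := adj_gridP (sub_adj_adj za).
have [j [s [bE _]]] := adj_gridP (sub_adj_adj zb).
rewrite {}aE in za; rewrite {}bE in zb.
have [ij|ij] := eqVneq i j; last by exists i, j, t, s.
have [l li] : exists l : 'I_d, l != i.
  have [i0|i0] := eqVneq (val i) 0%N.
    by exists (Ordinal d1); rewrite -(inj_eq val_inj) /= i0.
  by exists (Ordinal (ltnW d1)); rewrite -(inj_eq val_inj) /= eq_sym.
have [u zu] : exists u : 'I_k, `|(z l : nat) - (u : nat)|%N = 1%N.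
  have [z0|z0] := eqVneq (z l : nat) 0%N.
    by exists (Ordinal k1) => /=; lia.
  have zk : ((z l).-1 < k)%N by have := ltn_ord (z l); lia.
  by exists (Ordinal zk) => /=; lia.
case/orP: (adj_colour A (adj_upd zu)) => zl; last by exists i, l, t, u; rewrite eq_sym.
by exists l, j, u, s; split=> //; rewrite -ij.
Qed.

Definition parity z : {ffun 'I_d -> bool} := [ffun i => odd (z i)].

(** The two edges at [z] span a 4-cycle to which [square_cap] applies. Its other three vertices
    differ from [z] by 1 in some coordinate, hence have another parity vector. *)
Lemma corner_cap (A : {set edge (grid k d)}) (z : point) : (1 < k)%N -> (1 < d)%N ->
  z \in touched A :&: touched (~: A) ->
  exists w : {ffun grid k d -> F2},
    [/\ w \in (espan A :&: espan (~: A))%VS, w z != 0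
      & forall x : point, x != z -> parity x = parity z -> w x = 0].
Proof.
move=> k1 d1 zZ; have [i [j [t [s [ij za zb]]]]] := bichromatic_corner k1 d1 zZ.
have dist l (u : 'I_k) : adj (z : grid k d) (upd z l u) -> `|(z l : nat) - (u : nat)|%N = 1%N.
  case/existsP => m /andP[/eqP]; rewrite ffunE; case: eqVneq => [->//|_].
  by rewrite distnn.
have zt := dist _ _ (sub_adj_adj za); have zs := dist _ _ (sub_adj_adj zb).
pose q := upd (upd z i t) j s.
have aq : adj (upd z i t : grid k d) q.
  by apply: adj_upd; rewrite ffunE eq_sym (negPf ij).
have bq : adj (upd z j s : grid k d) q.
  have -> : q = upd (upd z j s) i t.
    apply/ffunP => l; rewrite !ffunE; case: (eqVneq l j) => [->|//].
    by rewrite eq_sym (negPf ij).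
  by apply: adj_upd; rewrite ffunE (negPf ij).
have par x l : parity x = parity z -> odd (x l) = odd (z l).
  by move=> /ffunP/(_ l); rewrite !ffunE.
have zq : (z : grid k d) != q.
  by apply/eqP => /ffunP/(_ j); rewrite !ffunE eqxx => zj; move: zs; rewrite zj distnn.
have [w [wcap wz w0]] := square_cap zq za zb aq bq.
exists w; split=> // x xz xpar; apply: w0; rewrite !inE (negPf xz) /=.
apply/negP => /or3P[] /eqP xE.
- by have := par x i xpar; rewrite xE ffunE eqxx; lia.
- by have := par x j xpar; rewrite xE ffunE eqxx; lia.
- by have := par x j xpar; rewrite xE ffunE eqxx; lia.
Qed.

(** Within each of the [2 ^ d] parity classes, the vectors given by [corner_cap] are independent by
    [dim_vspan_dual], so the class has at most as many vertices as the dimension. *)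
Lemma card_touched_cap (A : {set edge (grid k d)}) : (1 < k)%N -> (1 < d)%N ->
  (#|touched A :&: touched (~: A)| <= 2 ^ d * \dim (espan A :&: espan (~: A)))%N.
Proof.
move=> k1 d1; set Z := _ :&: _; set D := \dim _.
have -> : #|Z| = (\sum_(c : {ffun 'I_d -> bool}) #|[set z in Z | parity z == c]|)%N.
  rewrite -sum1_card (partition_big parity predT) //=.
  by apply: eq_bigr => c _; rewrite -sum1_card; apply: eq_bigl => z; rewrite !inE.
have -> : (2 ^ d = #|{ffun 'I_d -> bool}|)%N by rewrite card_ffun card_bool card_ord.
rewrite -sum_nat_const; apply: leq_sum => c _; set W := [set z in _ | _].
have /choice [w wP] z : exists w : {ffun grid k d -> F2}, z \in W ->
    [/\ w \in (espan A :&: espan (~: A))%VS, w z != 0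
      & forall x : point, x != z -> parity x = parity z -> w x = 0].
  have [zW|zW] := boolP (z \in W); last by exists 0.
  by case/setIdP: zW => /(corner_cap k1 d1)[w wP] _; exists w.
rewrite -(@dim_vspan_dual (grid k d) w W).
- by apply/dimvS/vspan_subP => z /wP[].
- by move=> z /wP[].
move=> z x zW xW zx; have [_ _ ->] := wP z zW => //; first by rewrite eq_sym.
by move: zW xW => /setIdP[_ /eqP ->] /setIdP[_ /eqP ->].
Qed.

End Grid.

(** * Lower bound: arithmetic and choice of the tree *)

(** Here [n], [e], [P] stand for [k ^ d], [k ^ d.-1], [2 ^ d]; [a] and [b] for the ranks of a colour
    class and of its complement, [D] for the dimension of the intersection of their spans, [Z] for
    the number of vertices touched by both. *)
Lemma defect_arith (r d P k e n a b D Z : nat) :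
  (1 < r)%N -> (0 < d)%N -> (0 < P)%N -> (0 < k)%N -> (8 <= n)%N -> (n = k * e)%N ->
  (n + D <= (a + b).+1)%N -> (a + b <= r * a)%N ->
  (a * b <= Z * (d * (n * k)))%N -> (Z <= P * D)%N ->
  ((16 * r * d * P) * n + e <= (16 * r * d * P) * (r * a).+1)%N.
Proof.
move=> r1 d0 P0 k0 n8 ne sum ra sep ZD; move KE: (16 * r * d * P)%N => K.
have K16 : (16 <= K)%N by rewrite -KE -!mulnA leq_pmulr // !muln_gt0 d0 P0 (ltnW r1).
have en : (e <= n)%N by rewrite ne leq_pmull.
(* If [a] is at least [3n/4], then [r * a >= 2 * a] exceeds [n] by a constant factor. Otherwise
   [b >= n/8], using [n >= 8], and [a * b] is of order [n ^ 2], which forces [D >= e / K]. *)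
have [big|small] := leqP (3 * n) (4 * a).
  have ra2 : (2 * a <= r * a)%N by rewrite leq_mul2r r1 orbT.
  have : (K * (2 * n + n) <= K * (2 * (r * a).+1))%N by rewrite leq_mul2l; apply/orP; right; lia.
  have : (16 * n <= K * n)%N by rewrite leq_mul2r K16 orbT.
  lia.
have nra : (n <= 2 * (r * a))%N by lia.
have nb : (n <= 8 * b)%N by lia.
suff eKD : (e <= K * D)%N.
  apply: (@leq_trans (K * (n + D))%N); first by rewrite mulnDr leq_add2l.
  by rewrite leq_mul2l; apply/orP; right; lia.
rewrite -(leq_pmul2l k0) -ne -(@leq_pmul2l n); last by lia.
apply: leq_trans (leq_mul nra nb) _.
have -> : (2 * (r * a) * (8 * b) = 16 * r * (a * b))%N by lia.
have -> : (n * (k * (K * D)) = 16 * r * (P * D * (d * (n * k))))%N by rewrite -KE; lia.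
rewrite leq_mul2l; apply/orP; right; apply: leq_trans sep _.
by rewrite leq_mul2r ZD orbT.
Qed.

(** Cleared of denominators, the inequality says that [r] times the number of edges of colour [i]
    exceeds [n - 1] by at least [k ^ d.-1 / K], with [n = k ^ d] and [K = 16 * r * d * 2 ^ d]. The
    colour [i] is one of maximal rank. *)
Lemma grid_colour_lower (k d r : nat) (f : {ffun edge (grid k d) -> 'I_r}) :
  (8 <= k)%N -> (1 < d)%N -> (1 < r)%N ->
  exists (T : {set edge (grid k d)}) (i : 'I_r), spanning_tree T /\
    ((16 * r * d * 2 ^ d) * k ^ d + k ^ d.-1 <=
     (16 * r * d * 2 ^ d) * (r * #|[set e in T | f e == i]|).+1)%N.
Proof.
move=> k8 d2 r2; have d0 : (0 < d)%N by lia.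
have i0 : 'I_r by exists 0%N; lia.
pose rk (j : 'I_r) := \dim (espan (colour_class f j)).
case: (@arg_maxnP _ i0 predT rk isT) => i _ maxi.
have [T treeT leT] := ex_colour_tree f (@grid_connected k d) i.
exists T, i; split=> //.
have le1 := rank_sum_setC (@grid_connected k d) (colour_class f i).
have le2 := rank_sum_colours i (fun j => maxi j isT).
have sep := touched_pairs (colour_class f i) d0.
have cap := card_touched_cap (colour_class f i) (ltac:(lia) : (1 < k)%N) d2.
have leA := dim_espan_touched (colour_class f i).
have leB := dim_espan_touched (~: colour_class f i).
rewrite card_grid in le1.
have kd : (k ^ d = k * k ^ d.-1)%N by rewrite -expnS prednK.
have kd8 : (8 <= k ^ d)%N.
  by rewrite kd; apply: (leq_trans k8); rewrite leq_pmulr // expn_gt0 (leq_trans _ k8).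
apply: leq_trans (defect_arith r2 d0 _ _ kd8 kd le1 le2 (leq_trans (leq_mul leA leB) sep) cap) _.
- by rewrite expn_gt0.
- by lia.
by rewrite leq_mul2l ltnS leq_mul2l leT !orbT.
Qed.

(** * Upper bound: colouring by slabs *)

Lemma leq_adj_coord (k d : nat) (x y : {ffun 'I_d -> 'I_k}) j :
  adj (x : grid k d) y -> (x j <= (y j).+1)%N.
Proof.
move=> /adj_gridP[i [t [-> it]]]; rewrite ffunE.
by case: eqVneq => [->|_]; lia.
Qed.

(** The successor lets the slab begin at coordinate [lo - 1] without truncated subtraction. A point
    is encoded by its offset in the slab and its remaining coordinates. *)
Lemma card_slab (k d lo s : nat) :
  (#|[set x : {ffun 'I_d.+1 -> 'I_k} | (lo <= (x ord0).+1 < lo + s.+1)%N]| <= s.+1 * k ^ d)%N.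
Proof.
set W := [set x | _].
pose g (x : {ffun 'I_d.+1 -> 'I_k}) : 'I_s.+1 * {ffun 'I_d -> 'I_k} :=
  (inord ((x ord0).+1 - lo), [ffun j => x (lift ord0 j)]).
have -> : (s.+1 * k ^ d = #|{: 'I_s.+1 * {ffun 'I_d -> 'I_k}}|)%N.
  by rewrite card_prod card_ffun !card_ord.
rewrite -(card_in_imset (f := g) (D := W)) ?max_card // => x y.
rewrite !inE => xW yW [/(congr1 val) /= + /ffunP xy]; rewrite !inordK; [|lia|lia] => xy0.
apply/ffunP => j; have [->|] := eqVneq j ord0; first by apply: val_inj => /=; lia.
case: (unliftP ord0 j) => [i ->|->]; last by rewrite eqxx.
by have := xy i; rewrite !ffunE.
Qed.

(* Colour an edge according to the slab of width [k %/ r + 1] in direction 0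
   containing one of its ends: the edges of one colour lie in a slab which is
   wider by 2. *)
Lemma grid_colour_upper (k d r : nat) :
  exists f : {ffun edge (grid k d.+1) -> 'I_r.+1},
  forall (T : {set edge (grid k d.+1)}) (i : 'I_r.+1), acyclic T ->
    (#|[set e in T | f e == i]| <= (k %/ r.+1 + 3) * k ^ d)%N.
Proof.
pose s := (k %/ r.+1).+1.
pose f : {ffun edge (grid k d.+1) -> 'I_r.+1} := [ffun e : edge (grid k d.+1) =>
  oapp (fun x : {ffun 'I_d.+1 -> 'I_k} => inord (x ord0 %/ s) : 'I_r.+1) ord0
    [pick x in val e]].
exists f => T i acT.
pose W : {set grid k d.+1} :=
  (* One layer is added on each side for the other ends of the edges, giving [s + 2 = k %/ r.+1 + 3]
     layers. *)
  [set x : {ffun 'I_d.+1 -> 'I_k} | (i * s <= (x ord0).+1 < i * s + s.+2)%N].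
rewrite addn3; apply: leq_trans (card_slab k d (i * s) s.+1).
have free : \dim (espan [set e in T | f e == i]) = #|[set e in T | f e == i]|.
  apply: dim_vspan_free => e /setIdP[eT _]; apply: contra (vspan_free_notin (acyclic_free acT) eT).
  by apply/subvP/vspanS/setSD/subsetP => e' /setIdP[].
rewrite -free; apply: (@dim_espan_verts _ _ W) => e /setIdP[_ /eqP].
have [x [y [xy exy]]] := edgeP e.
rewrite ffunE; case: pickP => [u ue|/(_ x)]; last by rewrite exy set21.
move=> ui; apply/subsetP => v ve; rewrite inE.
pose u0 := (u : {ffun 'I_d.+1 -> 'I_k}) ord0; pose v0 := (v : {ffun 'I_d.+1 -> 'I_k}) ord0.
have {}ui : (u0 %/ s = i)%N.
  (* [inord] is exact here: [r.+1] slabs of width [s] cover all [k] coordinates. *)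
  rewrite -ui inordK // ltn_divLR // (leq_trans (ltn_ord _)) //.
  by rewrite /s mulnS addnC mulnC; have := divn_eq k r.+1; have := ltn_pmod k (ltn0Sn r); lia.
have [uv vu] : (u0 <= v0.+1)%N /\ (v0 <= u0.+1)%N.
  move: ue ve; rewrite /u0 /v0 exy => /set2P[->|->] /set2P[->|->]; split=> //.
  - exact: leq_adj_coord.
  - by apply: leq_adj_coord; rewrite adj_sym.
  - by apply: leq_adj_coord; rewrite adj_sym.
  - exact: leq_adj_coord.
have := divn_eq u0 s; have := ltn_pmod u0 (ltn0Sn (k %/ r.+1)).
rewrite ui -/s -/v0; move: (u0 : nat) (v0 : nat) (i : nat) (s) uv vu => a b j w; lia.
Qed.

(** * From bounds on trees to the order of magnitude of the discrepancy *)

Lemma spanning_tree_discrepancy_bounds (R : realType) (G : sgraph) (r : nat) (lo up : R) :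
  (forall f : {ffun edge G -> 'I_r}, exists2 T : {set edge G},
     spanning_tree T & lo <= tree_discrepancy R f T) ->
  (exists f : {ffun edge G -> 'I_r}, forall T : {set edge G},
     spanning_tree T -> tree_discrepancy R f T <= up) ->
  lo <= spanning_tree_discrepancy G R r <= up.
Proof.
move=> lower [f0 upper]; rewrite /spanning_tree_discrepancy.
set D := \big[_/_]_f _.
have loD : (lo%:E <= D)%E.
  apply: le_bigmin => [|f _]; first exact: leey.
  have [T treeT loT] := lower f.
  by apply: le_trans (le_bigmax_cond _ _ treeT); rewrite lee_fin.
have Dup : (D <= up%:E)%E.
  rewrite /D; apply: (le_trans (bigmin_le _ f0 _)).
  apply: bigmax_le => [|T treeT]; first exact: leNye.
  by rewrite lee_fin upper.
(* Squeezed between two reals, [D] is finite, so [fine] returns its actual value. *)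
move: D loD Dup => [D||] //=; first by rewrite !lee_fin => -> ->.
Qed.

Lemma tree_discrepancyE (R : realType) (G : sgraph) (r : nat)
    (f : {ffun edge G -> 'I_r}) (T : {set edge G}) : (0 < r)%N ->
  tree_discrepancy R f T =
    (r * \max_(i < r) #|[set e in T | f e == i]|).+1%:R - #|G|%:R.
Proof.
move=> r0; rewrite /tree_discrepancy mulrBr mulrCA divff ?mulr1 ?pnatr_eq0 -?lt0n //.
by rewrite -natr1 natrM opprB addrA.
Qed.

Local Open Scope classical_set_scope.
Local Open Scope ring_scope.

Theorem corollary1p9 (R : realType) (r d : nat)
    (hr : (2 <= r)%N) (hd : (2 <= d)%N) :
  (fun k : nat => spanning_tree_discrepancy (grid k d) R r)
    =Theta_\oo (fun k : nat => k%:R ^+ d.-1 : R).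
Proof.
apply/eqTheta_nearP; pose K := (16 * r * d * 2 ^ d)%N.
have K0 : (0 < K)%N by rewrite /K !muln_gt0 expn_gt0 !andbT; lia.
(* The lower constant is that of [grid_colour_lower]. For the upper one, the slabs give [r * (k %/ r
   + 3) * k ^ d.-1 + 1 - k ^ d <= 3 * r * k ^ d.-1 + 1], and the last 1 is at most [k ^ d.-1]. *)
exists K%:R^-1, (3 * r).+1%:R; split; [by rewrite invr_gt0 ltr0n | by rewrite ltr0n |].
near=> k.
have k8 : (8 <= k)%N by near: k; exists 8%N.
rewrite -natrX (ger0_norm (ler0n _ _)).
have r0 : (0 < r)%N by apply: ltnW.
suff /andP[lo up] : K%:R^-1 * (k ^ d.-1)%:R <= spanning_tree_discrepancy (grid k d) R r
    <= (3 * r).+1%:R * (k ^ d.-1)%:R.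
  by rewrite ger0_norm ?lo // (le_trans _ lo) // mulr_ge0.
apply: spanning_tree_discrepancy_bounds.
- move=> f; have [T [i [treeT leT]]] := grid_colour_lower f k8 hd hr.
  exists T => //; rewrite tree_discrepancyE // card_grid mulrC ler_pdivrMr ?ltr0n //.
  rewrite mulrBl lerBrDr -!natrM -natrD ler_nat mulnC [X in (_ <= X)%N]mulnC.
  rewrite addnC; apply: leq_trans leT _.
  by rewrite leq_mul2l ltnS leq_mul2l (leq_bigmax i) !orbT.
- case: d hd {K K0} => // d' _; case: r hr r0 => // r' _ _.
  have [f upper] := grid_colour_upper k d' r'.
  exists f => T /andP[_ acT]; rewrite tree_discrepancyE // card_grid lerBlDr -natrM -natrD ler_nat.
  have maxT : (\max_(i < r'.+1) #|[set e in T | f e == i]%SET| <= (k %/ r'.+1 + 3) * k ^ d')%N.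
    by apply/bigmax_leqP => i _; apply: upper.
  have kd : (0 < k ^ d')%N by rewrite expn_gt0 (leq_trans _ k8).
  rewrite expnS; apply: (@leq_trans (r'.+1 * ((k %/ r'.+1 + 3) * k ^ d')).+1%N).
    by rewrite ltnS leq_mul2l maxT orbT.
  have : (r'.+1 * (k %/ r'.+1) * k ^ d' <= k * k ^ d')%N.
    by rewrite leq_mul2r mulnC leq_divM orbT.
  move: (_ ^ _)%N (_ %/ _)%N kd => e q e0 h; lia.
Unshelve. all: by end_near.
Qed.
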